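(* Let $H=(V,E)$ be an irregular connected graph of maximum degree $\Delta$ with at least two vertices, and let $\phi_H$ be the $\ell_2$-normalized Perron vector of its (unnormalized) adjacency matrix $A_H$. Then there is a vertex $u\in V$ with degree strictly less than $\Delta$ satisfying $$\phi_H(u)\ \ge\ \frac{1}{\Delta^{2}\,\lambda_1(A_H)\,|V|^{5/2}}.$$
   Context: Graphs are finite, undirected, and may have multiedges and self-loops; the degree of a vertex is the corresponding row sum of the adjacency matrix (each self-loop contributes one). A graph is irregular if not all its vertices have the same degree. $\lambda_1(A_H)$ is the largest eigenvalue of $A_H$, and the Perron vector is the unique strictly positive unit eigenvector for $\lambda_1(A_H)$. *)

(* Defs.v *)
From HB Require Import structures.
From mathcomp Require Import all_boot all_order all_algebra.
From mathcomp Require Import boolp classical_sets reals exp.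
Set Implicit Arguments.
Unset Strict Implicit.
Unset Printing Implicit Defensive.
Import Order.TTheory GRing.Theory Num.Theory.
Local Open Scope ring_scope.

(* [ends e] has one element exactly when [e] is a self-loop; parallel edges are
   distinct elements of [edge] with the same [ends]. *)
Record multigraph := Multigraph {
  vertex : finType;
  edge : finType;
  ends : edge -> {set vertex};
  ends_card : forall e : edge, (0 < #|ends e| <= 2)%N
}.

Section Multigraph.
Variable H : multigraph.
Implicit Types u v : vertex H.

(* For [u = v], [[set u; v]] is the singleton of [u], so a self-loop counts
   once. *)
Definition adj u v : nat := #|[set e : edge H | ends e == [set u; v]]%SET|.

Definition degree u : nat := \sum_(v : vertex H) adj u v.

Definition max_degree : nat := \max_(u : vertex H) degree u.

Definition regular : Prop := forall u v, degree u = degree v.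

Definition irregular : Prop := ~ regular.

Definition connected_graph : Prop :=
  forall u v, connect (fun x y => (0 < adj x y)%N) u v.

End Multigraph.

Section Spectrum.
Variables (R : realType) (H : multigraph).

Definition adjacency_mx : 'M[R]_#|vertex H| :=
  \matrix_(i, j) (adj (enum_val i) (enum_val j))%:R.

(* [adjacency_mx] is real symmetric, so as soon as [H] has a vertex its set of
   real eigenvalues is finite and nonempty and the supremum is the largest
   eigenvalue. *)
Definition lambda1 : R := sup [set a : R | eigenvalue adjacency_mx a]%classic.

(* Vectors are rows, as in [eigenvalue]; this is immaterial since
   [adjacency_mx] is symmetric. *)
Definition is_perron_vector (phi : 'rV[R]_#|vertex H|) : Prop :=
  [/\ phi *m adjacency_mx = lambda1 *: phi,
      forall i, 0 < phi 0 i
    & Num.sqrt (\sum_i phi 0 i ^+ 2) = 1].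

End Spectrum.

(* Main.v *)
(** Idea.  Write [D] for the maximum degree, [n] for the number of vertices, [f]
    for the Perron vector, [M] for its maximum and [m] for its maximum over the
    vertices of degree less than [D].  Expanding the quadratic form of [D - A]
    gives
    [D - lambda1 = \sum_x (D - degree x) * f x ^ 2 + \sum_(xy edge) (f x - f y) ^ 2],
    and Cauchy-Schwarz along a path from a vertex of degree less than [D] to a
    maximum of [f] bounds the right-hand side below by [M ^ 2 / n].  On the other
    hand, summing the eigenvector equation gives
    [(D - lambda1) * \sum_x f x = \sum_x (D - degree x) * f x <= n * D * m].
    Since [M * \sum_x f x >= \sum_x f x ^ 2 = 1] and [M >= n ^ (- 1 / 2)], this
    yields [m >= n ^ (- 5 / 2) / D], and [D] and [lambda1] are at least 1. *)
Require Import Defs.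
From mathcomp Require Import all_boot all_order all_algebra.
From mathcomp Require Import boolp classical_sets reals exp.
From mathcomp Require Import ring lra.
Import Order.TTheory GRing.Theory Num.Theory.
Local Open Scope ring_scope.

(** The induction step of Cauchy-Schwarz for a sum of [k + 1] increments, free of division: [b] is
    the sum of the first [k] and [c] bounds their squares. If [k = 0] then [b = 0]; otherwise the
    claim reduces to [(k * a - b) ^ 2 >= 0]. *)
Lemma sqr_add_le (R : realFieldType) (k a b c : R) :
  0 <= k -> 0 <= c -> b ^+ 2 <= k * c -> (a + b) ^+ 2 <= (k + 1) * (a ^+ 2 + c).
Proof.
move=> k0 c0 hb; suff: 2 * (a * b) <= k * a ^+ 2 + c by nra.
have [k00|kN0] := eqVneq k 0.
  have/eqP: b ^+ 2 = 0.
    by apply/le_anti; rewrite sqr_ge0 andbT (le_trans hb)// k00 mul0r.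
  by rewrite sqrf_eq0 => /eqP->; rewrite k00; lra.
have kp : 0 < k by rewrite lt_neqAle eq_sym kN0.
by rewrite -(ler_pM2l kp); have := sqr_ge0 (k * a - b); nra.
Qed.

Section WeightedGraph.
Context {R : realFieldType} {T : Type}.
Variables (w : T -> T -> R) (f : T -> R).
Hypotheses (w_ge0 : forall x y, 0 <= w x y) (w_sym : forall x y, w x y = w y x).

Let dir x y := w x y * (f x - f y) ^+ 2.

Let dir_ge0 x y : 0 <= dir x y.
Proof. by rewrite mulr_ge0 ?sqr_ge0. Qed.

Let dir_sym x y : dir x y = dir y x.
Proof. by rewrite /dir w_sym -sqrrN opprB. Qed.

(** Each step has weight at least 1, so its energy bounds its squared increment. The double sum runs
    over ordered pairs and sees each step twice, whence the factor 2. *)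
Lemma path_energy (x : T) (p : seq T) : path (fun y z => 1 <= w y z) x p ->
  2 * (f (last x p) - f x) ^+ 2 <=
  (size p)%:R * \sum_(y <- x :: p) \sum_(z <- x :: p) w y z * (f y - f z) ^+ 2.
Proof.
rewrite -/(\sum_(y <- x :: p) \sum_(z <- x :: p) dir y z).
elim: p x => [x _|y p IH x] /=; first by rewrite subrr expr0n mulr0 mul0r.
case/andP=> wxy /IH {IH}; set E := \sum_(z <- y :: p) _ => IH.
have E_ge0 : 0 <= E by rewrite !sumr_ge0// => ? _; rewrite sumr_ge0.
(* Prepending [x] adds a row and a column to the double sum; each contains the pair of [x] and [y],
   and the other new terms are nonnegative. *)
have step : 2 * (f y - f x) ^+ 2 + E <=
    \sum_(z <- x :: y :: p) \sum_(t <- x :: y :: p) dir z t.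
  rewrite [leRHS]big_cons [X in _ <= X + _]big_cons.
  under [X in _ <= _ + X]eq_bigr => z _ do rewrite big_cons dir_sym.
  rewrite big_split /= -/E [\sum_(t <- y :: p) dir x t]big_cons.
  have S_ge0 : 0 <= \sum_(t <- p) dir x t by rewrite sumr_ge0.
  have dxy : (f y - f x) ^+ 2 <= dir x y.
    by rewrite dir_sym /dir w_sym ler_peMl ?sqr_ge0.
  have := dir_ge0 x x; lra.
rewrite -natr1.
have -> : f (last y p) - f x = (f y - f x) + (f (last y p) - f y) by ring.
have : (f (last y p) - f y) ^+ 2 <= (size p)%:R * (E / 2) by lra.
move/(sqr_add_le _ _ (f y - f x) _ _ (ler0n R _) (divr_ge0 E_ge0 (ler0n R 2))).
have : ((size p)%:R + 1) * (2 * (f y - f x) ^+ 2 + E) <=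
  ((size p)%:R + 1) * \sum_(z <- x :: y :: p) \sum_(t <- x :: y :: p) dir z t.
  by rewrite ler_wpM2l// addr_ge0.
lra.
Qed.

End WeightedGraph.

Lemma le_sum_uniq (R : numDomainType) (T : finType) (s : seq T) (F : T -> R) :
  uniq s -> (forall x, 0 <= F x) -> \sum_(x <- s) F x <= \sum_x F x.
Proof.
move=> us F_ge0; rewrite big_uniq //= [leRHS](bigID [in s]) /=.
by rewrite lerDl sumr_ge0.
Qed.

(** Twice the quadratic form of the weighted Laplacian. The two square terms agree by symmetry of
    [w]; self-loops cancel on the right. *)
Lemma energyE (R : comRingType) (T : finType) (w : T -> T -> R) (f : T -> R) :
  (forall x y, w x y = w y x) ->
  \sum_x \sum_y w x y * (f x - f y) ^+ 2 =
  2 * \sum_x (\sum_y w x y) * f x ^+ 2 - 2 * \sum_x f x * \sum_y w x y * f y.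
Proof.
move=> w_sym.
transitivity (\sum_x \sum_y w x y * f x ^+ 2 + \sum_x \sum_y w x y * f y ^+ 2
    - 2 * \sum_x f x * \sum_y w x y * f y).
  rewrite mulr_sumr -big_split -sumrB /=; apply: eq_bigr => x _.
  rewrite mulrA mulr_sumr -big_split -sumrB /=; apply: eq_bigr => y _.
  ring.
rewrite [X in _ + X - _]exchange_big /=.
under [X in _ + X - _]eq_bigr => x _ do under eq_bigr => y _ do rewrite w_sym.
rewrite -mulr2n -[X in X - _]mulr_natl; congr (_ * _ - _).
by apply: eq_bigr => x _; rewrite mulr_suml.
Qed.

(** * Degrees and eigenvectors of a multigraph *)

Section Multigraph.
Context {H : multigraph}.

Lemma adj_sym (u v : vertex H) : adj u v = adj v u.
Proof. by rewrite /adj finset.setUC. Qed.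

Lemma degree_le_max (u : vertex H) : (degree u <= max_degree H)%N.
Proof. exact: leq_bigmax. Qed.

Lemma irregular_lt_max_degree :
  irregular H -> exists u : vertex H, (degree u < max_degree H)%N.
Proof.
move=> irr; apply: contrapT => noU; apply: irr => u v.
have eqD (x : vertex H) : degree x = max_degree H.
  apply/eqP; rewrite eqn_leq degree_le_max leqNgt.
  by apply/negP => ltx; apply: noU; exists x.
by rewrite !eqD.
Qed.

Lemma connected_degree_gt0 (u : vertex H) :
  (2 <= #|vertex H|)%N -> connected_graph H -> (0 < degree u)%N.
Proof.
move=> n2 conn.
have [v vu] : exists v, v != u.
  apply/existsP; rewrite -negb_forall; apply: contraL n2 => /forallP all_u.
  rewrite -leqNgt -(card1 u) subset_leq_card//.
  by apply/fintype.subsetP => x _; rewrite inE; apply: all_u.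
case/connectP: (conn u v) => [[|y p]] /= => [_ vE|/andP[uy _] _].
  by rewrite vE eqxx in vu.
by rewrite /degree (bigD1 y)//= ltn_addr.
Qed.

Lemma degree_natr (R : semiRingType) (u : vertex H) :
  (degree u)%:R = \sum_v (adj u v)%:R :> R.
Proof. by rewrite natr_sum. Qed.

Lemma eigenvector_vertexE (R : realType) (phi : 'rV[R]_#|vertex H|) (a : R) :
  phi *m adjacency_mx R H = a *: phi -> forall u : vertex H,
  \sum_v (adj u v)%:R * phi 0 (enum_rank v) = a * phi 0 (enum_rank u).
Proof.
move=> /rowP eigen u; have := eigen (enum_rank u); rewrite !mxE => <-.
rewrite [RHS](reindex enum_rank (onW_bij _ (@enum_rank_bij _))) /=; apply: eq_bigr => v _.
by rewrite mxE !enum_rankK mulrC adj_sym.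
Qed.

(** The eigenvector equation paired with the all-ones vector, which the adjacency matrix sends to
    the degrees. *)
Lemma sum_max_degree_sub (R : realType) (f : vertex H -> R) (a : R) :
  (forall u, \sum_v (adj u v)%:R * f v = a * f u) ->
  \sum_u ((max_degree H)%:R - (degree u)%:R) * f u =
  ((max_degree H)%:R - a) * \sum_u f u.
Proof.
move=> eigen; rewrite mulrBl !mulr_sumr.
under eq_bigr => u _ do rewrite mulrBl.
rewrite sumrB; congr (_ - _).
under [RHS]eq_bigr => u _ do rewrite -eigen.
rewrite exchange_big /=; apply: eq_bigr => u _.
by rewrite degree_natr mulr_suml; apply: eq_bigr => v _; rewrite adj_sym.
Qed.

Lemma spectral_gap (R : realType) (f : vertex H -> R) (a : R) (u v : vertex H) :
  connected_graph H -> (degree u < max_degree H)%N ->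
  (forall u, \sum_v (adj u v)%:R * f v = a * f u) ->
  f v ^+ 2 <= #|vertex H|%:R * (((max_degree H)%:R - a) * \sum_x f x ^+ 2).
Proof.
move=> conn ltu eigen.
pose w (x y : vertex H) : R := (adj x y)%:R.
have w_ge0 x y : 0 <= w x y by apply: ler0n.
have w_sym x y : w x y = w y x by rewrite /w adj_sym.
have w_eigen x : \sum_y w x y * f y = a * f x by apply: eigen.
have w_degree x : \sum_y w x y = (degree x)%:R by rewrite degree_natr.
pose E := \sum_x \sum_y w x y * (f x - f y) ^+ 2.
have E_ge0 : 0 <= E by rewrite !sumr_ge0// => ? _; rewrite sumr_ge0// => ? _;
  rewrite mulr_ge0 ?sqr_ge0.
have gapE : ((max_degree H)%:R - a) * \sum_x f x ^+ 2 =
    \sum_x ((max_degree H)%:R - (degree x)%:R) * f x ^+ 2 + E / 2.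
  have -> : E = 2 * \sum_x (degree x)%:R * f x ^+ 2 - 2 * (a * \sum_x f x ^+ 2).
    rewrite /E energyE// [a * _]mulr_sumr.
    by congr (_ * _ - _ * _); apply: eq_bigr => x _;
      rewrite ?w_degree ?w_eigen// mulrCA expr2.
  under [\sum_x (_ - _) * _]eq_bigr => x _ do rewrite mulrBl.
  by rewrite sumrB -mulr_sumr; field.
have defect : f u ^+ 2 <=
    \sum_x ((max_degree H)%:R - (degree x)%:R) * f x ^+ 2.
  rewrite (bigD1 u)//= -[leLHS]addr0 lerD//.
    (* Degrees are integers, so the defect at [u] is at least 1. *)
    by rewrite ler_peMl ?sqr_ge0// lerBrDr nat1r ler_nat.
  by rewrite sumr_ge0// => x _; rewrite mulr_ge0 ?sqr_ge0// subr_ge0 ler_nat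
    degree_le_max.
(* A path without repeated vertices: its energy is then part of [E], and it has at most
   [#|vertex H|] vertices. *)
case/connectP: (conn u v) => p0 /shortenP[p up uniq_p _] ->.
have wp : path (fun x y => 1 <= w x y) u p.
  by apply: sub_path up => x y; rewrite /w ler1n.
have := path_energy w f w_ge0 w_sym u p wp.
set F := (F in _ <= _ * F); have F_le : F <= E.
  apply: le_trans (le_sum_uniq _ _ _ _ uniq_p _) => [|x]; last first.
    by rewrite sumr_ge0// => y _; rewrite mulr_ge0 ?sqr_ge0.
  apply: ler_sum => x _; apply: le_sum_uniq => // y.
  by rewrite mulr_ge0 ?sqr_ge0.
move=> steps; have k_ge0 := ler0n R (size p).
have {}steps : (f (last u p) - f u) ^+ 2 <= (size p)%:R * (E / 2) by nra.
(* The value [f u] counts as one more increment, paid for by the defect; the factor becomes the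
   number of vertices on the path. *)
have := sqr_add_le _ _ (f u) _ _ k_ge0 (divr_ge0 E_ge0 (ler0n R 2)) steps.
rewrite addrC subrK natr1 gapE => /le_trans; apply.
apply: ler_pM; rewrite ?addr_ge0 ?sqr_ge0 ?divr_ge0 ?lerD2r//.
by rewrite ler_nat -[(size p).+1]/(size (u :: p)) -(card_uniqP uniq_p) max_card.
Qed.

End Multigraph.

Lemma powR_5div2 (R : realType) (x : R) : 0 <= x ->
  x `^ (5 / 2) = x ^+ 2 * Num.sqrt x.
Proof.
move=> x_ge0; have -> : 5 / 2 = 2%:R + 2^-1 :> R by field.
by rewrite powRD ?powR_mulrn ?powR12_sqrt//; apply/implyP => /eqP; lra.
Qed.

Theorem corollary1p5 (R : realType) (H : multigraph)
    (phi : 'rV[R]_#|vertex H|)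
    (H_vertices : (2 <= #|vertex H|)%N)
    (H_connected : connected_graph H)
    (H_irregular : irregular H)
    (phi_perron : is_perron_vector phi) :
  exists u : vertex H,
    (degree u < max_degree H)%N /\
    phi 0 (enum_rank u) >=
      1 / ((max_degree H)%:R ^+ 2 * lambda1 R H * #|vertex H|%:R `^ (5 / 2)).
Proof.
case: phi_perron => /eigenvector_vertexE eigen phi_gt0 phi_unit.
pose f v := phi 0 (enum_rank v).
have f_gt0 v : 0 < f v by apply: phi_gt0.
have f_ge0 v : 0 <= f v by apply: ltW.
have f_unit : \sum_v f v ^+ 2 = 1.
  have -> : \sum_v f v ^+ 2 = \sum_i phi 0 i ^+ 2.
    by rewrite [RHS](reindex enum_rank (onW_bij _ (@enum_rank_bij _))).
  by rewrite -[LHS]sqr_sqrtr ?phi_unit ?expr1n// sumr_ge0// => i _; apply: sqr_ge0.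
have [u0 u0_lt] := irregular_lt_max_degree H_irregular.
case: (@arg_maxP _ _ _ u0 (fun u => degree u < max_degree H)%N f u0_lt) => u u_lt u_max.
case: (@arg_maxP _ _ _ u0 predT f isT) => v _ v_max.
exists u; split=> //.
rewrite -/(f u).
have gap := spectral_gap _ f _ u v H_connected u_lt eigen.
rewrite f_unit mulr1 in gap.
have defect := sum_max_degree_sub _ f _ eigen.
rewrite powR_5div2//; move: gap defect.
set n := #|vertex H|%:R; set D := (max_degree H)%:R; set L := lambda1 R H.
move=> gap defect.
have n_gt0 : 0 < n by rewrite /n ltr0n (leq_trans _ H_vertices).
have D_ge1 : 1 <= D by rewrite /D ler1n (leq_trans _ u_lt).
have S_gt0 : 0 < \sum_x f x.
  by rewrite (bigD1 u)//= ltr_wpDr// sumr_ge0// => x _; apply: f_ge0.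
(* [L] is the average of the degrees with weights [f], and all degrees are positive. *)
have L_ge1 : 1 <= L.
  rewrite -(ler_pM2r S_gt0) mul1r.
  have -> : L * \sum_x f x = \sum_x (degree x)%:R * f x.
    move: defect; under eq_bigr => x _ do rewrite mulrBl.
    by rewrite sumrB -mulr_sumr mulrBl => /addrI/oppr_inj.
  by apply: ler_sum => x _; rewrite ler_peMl// ler1n connected_degree_gt0.
have MS : 1 <= f v * \sum_x f x.
  rewrite -f_unit mulr_sumr; apply: ler_sum => x _.
  by rewrite expr2 ler_wpM2r//; apply: v_max.
have Mn : 1 <= f v * Num.sqrt n.
  rewrite -(@ler_pXn2r _ 2) ?nnegrE ?mulr_ge0 ?sqrtr_ge0//.
  rewrite expr1n exprMn sqr_sqrtr// -f_unit mulrC mulr_natl -sumr_const.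
  apply: ler_sum => x _; rewrite ler_pXn2r ?nnegrE//; exact: v_max.
(* Vertices of maximum degree contribute 0, the others at most [D * f u] by the choice of [u]. *)
have defect_le : (D - L) * \sum_x f x <= n * (D * f u).
  rewrite -defect mulr_natl -sumr_const; apply: ler_sum => x _.
  have [x_lt|x_ge] := ltnP (degree x) (max_degree H).
    apply: ler_pM; rewrite ?subr_ge0 ?ler_nat ?degree_le_max//.
      by rewrite gerBl.
    exact: u_max.
  have -> : degree x = max_degree H.
    by apply/eqP; rewrite eqn_leq degree_le_max x_ge.
  by rewrite subrr mul0r mulr_ge0// ltW.
(* The chain uses in turn [MS], [gap] and [defect_le]. *)
have M_le : f v <= n ^+ 2 * (D * f u).
  apply: (@le_trans _ _ (f v ^+ 2 * \sum_x f x)).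
    by rewrite expr2 -mulrA ler_peMr// ltW.
  apply: (@le_trans _ _ (n * (D - L) * \sum_x f x)).
    by rewrite ler_wpM2r// ltW.
  by rewrite -mulrA expr2 -mulrA ler_wpM2l// ltW.
have s_gt0 : 0 < Num.sqrt n by rewrite sqrtr_gt0.
rewrite ler_pdivrMr; last first.
  by rewrite !mulr_gt0// ?exprn_gt0//; apply: lt_le_trans ltr01 _.
apply: (le_trans Mn); apply: (@le_trans _ _ (n ^+ 2 * (D * f u) * Num.sqrt n)).
  by rewrite ler_wpM2r// ltW.
(* The bound obtained has [D] where the goal has [D ^ 2 * L]; the surplus [D * L] is at least 1. *)
have -> : f u * (D ^+ 2 * L * (n ^+ 2 * Num.sqrt n)) =
  (D * L) * (n ^+ 2 * (D * f u) * Num.sqrt n) by ring.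
rewrite ler_peMl//; last by rewrite -[1]mulr1 ler_pM.
by rewrite !mulr_ge0// ?exprn_ge0// ltW// (lt_le_trans ltr01).
Qed.
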